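(* For each odd integer $d\ge 5$, there are only finitely many graphs of degree $d$ with cyclic defect (of any diameter) or with cyclic excess (of any odd girth). Moreover, the number of such graphs of degree $d$ is bounded asymptotically by $O\!\left(\tfrac{64}{3}d^{3/2}\right)$.
   Context: For an integer $d\ge 1$ define polynomials $G_{d,m}(x)$ by $G_{d,0}(x)=1$, $G_{d,1}(x)=x+1$, and $G_{d,m+1}(x)=xG_{d,m}(x)-(d-1)G_{d,m-1}(x)$ for $m\ge1$. Let $J_n$ be the $n\times n$ all-ones matrix. For a graph on $n\ge3$ vertices, a cycle matrix is the adjacency matrix $B$ of an $n$-cycle on the same vertex set (i.e., for some ordering $v_1,\dots,v_n$ of the vertices, $B_{ij}=1$ iff $v_i,v_j$ are cyclically consecutive, and $0$ otherwise); this cycle need not consist of edges of the graph. A graph $\Gamma$ of order $n$ with adjacency matrix $A$ is a graph of degree $d$, diameter $D$ and cyclic defect if $\Gamma$ is $d$-regular with $d\ge3$, has diameter $D\ge2$, and $G_{d,D}(A)=J_n+B$ for some cycle matrix $B$. It is a graph of degree $d$, girth $g$ and cyclic excess if $\Gamma$ is $d$-regular with $d\ge3$, has odd girth $g\ge5$, and $G_{d,\lfloor g/2\rfloor}(A)=J_n-B$ for some cycle matrix $B$. *)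

(* Defs.v *)
From HB Require Import structures.
From mathcomp Require Export all_boot all_order all_algebra.
From mathcomp Require Export perm finmap.
From mathcomp Require Export all_classical all_reals all_analysis.

Set Implicit Arguments.
Unset Strict Implicit.
Unset Printing Implicit Defensive.

Import Order.TTheory GRing.Theory Num.Theory.
Import numFieldNormedType.Exports.

Local Open Scope ring_scope.

Fixpoint Gpoly (d m : nat) : {poly int} :=
  match m with
  | 0 => 1
  | S m1 =>
    match m1 with
    | 0 => 'X + 1
    | S m2 => 'X * Gpoly d m1 - (d%:Z - 1)%:P * Gpoly d m2
    end
  end.

(* Finite simple graphs. As isomorphism classes are what is counted, the
   vertex set is an ordinal type; it is nonempty, which is no restriction for
   regular graphs of positive degree with a diameter or a girth, and makes
   square matrices a ring, as horner_mx requires. *)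
Record sgraph := SGraph {
  order_pred : nat;
  adj : rel 'I_order_pred.+1;
  adj_sym : symmetric adj;
  adj_irr : irreflexive adj
}.

Definition vertex (G : sgraph) : finType := 'I_((order_pred G).+1).

Definition adj_mx (G : sgraph) : 'M[int]_((order_pred G).+1) :=
  \matrix_(i, j) (adj i j)%:R.

Definition graph_iso (G H : sgraph) : Prop :=
  exists2 f : vertex G -> vertex H,
    bijective f & forall x y, adj (f x) (f y) = adj x y.

Definition regular (d : nat) (G : sgraph) : Prop :=
  forall x : vertex G, #|[set y | adj x y]%SET| = d.

Section Metric.
Variables (T : finType) (e : rel T).

Definition walk_of_length (x y : T) (k : nat) : Prop :=
  exists p : seq T, [/\ path e x p, last x p = y & size p = k].

Definition is_distance (x y : T) (k : nat) : Prop :=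
  walk_of_length x y k /\ forall l, walk_of_length x y l -> (k <= l)%N.

(* In particular the graph is connected. *)
Definition is_diameter (D : nat) : Prop :=
  (forall x y, exists2 k, is_distance x y k & (k <= D)%N) /\
  (exists x y, is_distance x y D).

Definition is_cycle (c : seq T) : Prop := ucycle e c /\ (3 <= size c)%N.

Definition is_girth (g : nat) : Prop :=
  (exists2 c, is_cycle c & size c = g) /\
  (forall c, is_cycle c -> (g <= size c)%N).

End Metric.

(* The cycle v_0, v_1, ..., v_(n-1), v_0; ordS is the cyclic successor. *)
Definition cycle_mx (n : nat) (v : 'S_n) : 'M[int]_n :=
  \matrix_(i, j) [exists k : 'I_n,
     ((i == v k) && (j == v (ordS k))) ||
     ((j == v k) && (i == v (ordS k)))]%:R.

Definition is_cycle_matrix (n : nat) (B : 'M[int]_n) : Prop :=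
  (3 <= n)%N /\ exists v : 'S_n, B = cycle_mx v.

Definition cyclic_defect (d D : nat) (G : sgraph) : Prop :=
  [/\ (3 <= d)%N, regular d G, (2 <= D)%N, is_diameter (@adj G) D &
      exists2 B, is_cycle_matrix B &
        horner_mx (adj_mx G) (Gpoly d D) = const_mx 1 + B].

Definition cyclic_excess (d g : nat) (G : sgraph) : Prop :=
  [/\ (3 <= d)%N, regular d G, odd g /\ (5 <= g)%N, is_girth (@adj G) g &
      exists2 B, is_cycle_matrix B &
        horner_mx (adj_mx G) (Gpoly d g./2) = const_mx 1 - B].

Local Open Scope classical_set_scope.

Definition cyclic_graphs (d : nat) : set sgraph :=
  [set G | (exists D, cyclic_defect d D G) \/ (exists g, cyclic_excess d g G)].

Definition iso_class (G : sgraph) : set sgraph := [set H | graph_iso G H].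

Definition cyclic_graph_classes (d : nat) : set (set sgraph) :=
  iso_class @` cyclic_graphs d.

(* fset_set A is the finite set A, and is empty when A is infinite. *)
Definition num_cyclic_graphs (d : nat) : nat :=
  #|` fset_set (cyclic_graph_classes d)|%fset.

(* d tends to infinity through the odd integers. *)
Notation odd_oo := (within [set d : nat | odd d] \oo).

(* Main.v *)
(* The classes are in fact empty. Since A commutes with J, it commutes with the
   cycle matrix B; with vertices indexed by Z/n along the cycle this says that
   a(i, j) solves the discrete wave equation, so a(i, j) = f(i - j) + g(i + j)
   on each parity class of i + j (n is even because d is odd). As a is 0/1-valued,
   on each class one of f and g is constant, and as the diagonal vanishes this is
   g on the even class: A is a Cayley graph of a cyclic or of a dihedral group.
   Now G_{d,k}(A) dominates G_{d,2}(A) entrywise, because the differences count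
   non-backtracking walks, so A^2 + A <= J + B off the diagonal. In the cyclic
   case commuting generators give too many pairs of 2-walks with the same ends.
   In the dihedral case the same count forces the alternating vector, an
   eigenvector for the eigenvalue -2 of B, to have A-eigenvalue d or -d, and
   G_{d,k} is larger than 2 in absolute value at both points. *)
Require Import Defs.
From mathcomp Require Import zify.
Import Order.TTheory GRing.Theory Num.Theory.
Import numFieldNormedType.Exports.
Local Open Scope classical_set_scope.
Local Open Scope ring_scope.

(** * Polynomials in a matrix, and the values of G_{d,m} at d and -d *)

Lemma horner_mx_eigen (R : comNzRingType) (n : nat) (A : 'M[R]_n.+1)
    (p : {poly R}) (u : 'cV[R]_n.+1) (c : R) :
  A *m u = c *: u -> horner_mx A p *m u = p.[c] *: u.
Proof.
move=> Au; elim/poly_ind: p => [|p b IHp].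
  by rewrite rmorph0 mul0mx horner0 scale0r.
rewrite rmorphD rmorphM /= horner_mx_X horner_mx_C hornerMXaddC mulmxDl.
by rewrite -[_ * A]/(_ *m A) -mulmxA Au -scalemxAr IHp mul_scalar_mx scalerA
  mulrC -scalerDl.
Qed.

Lemma horner_mx_mxsub (R : comNzRingType) (n : nat) (A : 'M[R]_n.+1)
    (p : {poly R}) (v : 'S_n.+1) :
  horner_mx (mxsub v v A) p = mxsub v v (horner_mx A p).
Proof.
elim/poly_ind: p => [|p b IHp].
  by rewrite !rmorph0; apply/matrixP=> i j; rewrite !mxE.
rewrite !rmorphD !rmorphM /= !horner_mx_X !horner_mx_C IHp.
apply/matrixP=> i j; rewrite !mxE (inj_eq perm_inj); congr (_ + _).
rewrite [RHS](reindex_inj (@perm_inj _ v)).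
by apply: eq_bigr => k _; rewrite !mxE.
Qed.

Lemma GpolySS (d m : nat) :
  Gpoly d m.+2 = 'X * Gpoly d m.+1 - (d%:Z - 1)%:P * Gpoly d m.
Proof. by []. Qed.

Lemma horner_mx_GpolySS (n d m : nat) (A : 'M[int]_n.+1) :
  horner_mx A (Gpoly d m.+2) =
  A *m horner_mx A (Gpoly d m.+1) - (d%:Z - 1) *: horner_mx A (Gpoly d m).
Proof.
rewrite GpolySS rmorphB !rmorphM /= horner_mx_X horner_mx_C.
by rewrite -[_%:M * _]/(_ *m _) mul_scalar_mx.
Qed.

Lemma horner_GpolySS (d m : nat) (c : int) :
  (Gpoly d m.+2).[c] =
  c * (Gpoly d m.+1).[c] - (d%:Z - 1) * (Gpoly d m).[c].
Proof. by rewrite GpolySS !hornerE. Qed.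

(** At -d the recurrence has characteristic roots -1 and 1 - d, and the initial values 1 and 1 - d
    select the second. *)
Lemma horner_GpolyN (d m : nat) :
  (Gpoly d m).[- d%:Z] = (1 - d%:Z) ^+ m.
Proof.
suff: (Gpoly d m).[- d%:Z] = (1 - d%:Z) ^+ m /\
      (Gpoly d m.+1).[- d%:Z] = (1 - d%:Z) ^+ m.+1 by case.
elim: m => [|m [IH1 IH2]]; first by split; rewrite /= !hornerE //; lia.
by split=> //; rewrite horner_GpolySS IH1 IH2 !exprS; lia.
Qed.

(** At x = d each increment is d - 1 times the preceding one, so increments stay at least 1. *)
Lemma horner_Gpoly_ge (d m : nat) : (1 < d)%N -> m%:Z + 1 <= (Gpoly d m).[d%:Z].
Proof.
move=> d1; suff: m%:Z + 1 <= (Gpoly d m).[d%:Z] /\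
  (Gpoly d m).[d%:Z] + 1 <= (Gpoly d m.+1).[d%:Z] by case.
elim: m => [|m [IH1 IH2]]; first by rewrite /= !hornerE; lia.
by rewrite horner_GpolySS; nia.
Qed.

Lemma horner_Gpoly_even (d m : nat) : odd d ->
  exists x : int, (Gpoly d m.+1).[d%:Z] = 2 * x.
Proof.
move=> od; suff [] : (exists x : int, (Gpoly d m.+1).[d%:Z] = 2 * x) /\
  (exists x : int, (Gpoly d m.+2).[d%:Z] = 2 * x) by [].
have [e ->]: exists e, d = (2 * e + 1)%N by exists d./2; lia.
elim: m => [|m [[x IHx] [y IHy]]]; split; last 2 [by exists y].
- by exists (e%:Z + 1); rewrite /= !hornerE; lia.
- by exists ((2 * e%:Z + 1) * (e%:Z + 1) - e%:Z); rewrite /= !hornerE; lia.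
- by exists ((2 * e + 1)%N%:Z * y - ((2 * e + 1)%N%:Z - 1) * x);
     rewrite horner_GpolySS IHx IHy; lia.
Qed.

(** * Non-backtracking walks and entrywise monotonicity of G_{d,m}(A) in m *)

Section NonBacktracking.
Variables (n d : nat) (e : rel 'I_n.+1).
Hypotheses (e_sym : symmetric e) (e_reg : forall i, \sum_j (e i j)%:R = d%:Z).
Let A : 'M[int]_n.+1 := \matrix_(i, j) (e i j)%:R.

(* Non-backtracking walks of length m from i to j whose first step avoids p. *)
Fixpoint nbwalks_avoiding (m : nat) (p i j : 'I_n.+1) : int :=
  if m is m'.+1
  then \sum_(q | e i q && (q != p)) nbwalks_avoiding m' i q j
  else (i == j)%:R.

Definition nbwalks (m : nat) (i j : 'I_n.+1) : int :=
  if m is m'.+1 then \sum_(q | e i q) nbwalks_avoiding m' i q j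
  else (i == j)%:R.

Lemma nbwalks_avoiding_ge0 m p i j : 0 <= nbwalks_avoiding m p i j.
Proof. by elim: m p i => [|m IHm] p i; [exact: ler0n | exact: sumr_ge0]. Qed.

Lemma nbwalks_ge0 m i j : 0 <= nbwalks m i j.
Proof.
case: m => [|m]; first exact: ler0n.
by apply: sumr_ge0 => q _; apply: nbwalks_avoiding_ge0.
Qed.

Lemma nbwalks_split m p i j : e i p ->
  nbwalks m.+1 i j = nbwalks_avoiding m.+1 p i j + nbwalks_avoiding m i p j.
Proof. by move=> eip; rewrite /nbwalks (bigD1 p) //= addrC. Qed.

(** A walk of positive length is counted once for each neighbour of [i] other than its first step,
    hence d - 1 times. *)
Lemma sum_nbwalks_avoiding m i j :
  \sum_(q | e i q) nbwalks_avoiding m.+1 q i j = (d%:Z - 1) * nbwalks m.+1 i j.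
Proof.
rewrite mulrBl mul1r -(e_reg i) mulr_suml.
rewrite (eq_bigr (fun q => nbwalks m.+1 i j - nbwalks_avoiding m i q j)).
  rewrite sumrB; congr (_ - _); rewrite big_mkcond /=.
  by apply: eq_bigr => q _; case: (e i q); rewrite ?mul1r ?mul0r.
by move=> q eiq; rewrite (@nbwalks_split m q) // addrK.
Qed.

Lemma sum_adj (f : 'I_n.+1 -> int) i :
  \sum_q (e i q)%:R * f q = \sum_(q | e i q) f q.
Proof.
rewrite [RHS]big_mkcond; apply: eq_bigr => q _.
by case: (e i q); rewrite ?mul1r ?mul0r.
Qed.

(** After prepending the step from [i] to [q], the last sum collects the walks that return to [i] at
    once. *)
Lemma nbwalksS m i j :
  \sum_q (e i q)%:R * nbwalks m.+1 q j =
  nbwalks m.+2 i j + \sum_(q | e i q) nbwalks_avoiding m q i j.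
Proof.
rewrite sum_adj.
rewrite -[nbwalks m.+2 i j]/(\sum_(q | e i q) nbwalks_avoiding m.+1 i q j).
rewrite -big_split; apply: eq_bigr => q eiq.
by rewrite (@nbwalks_split m i) // e_sym.
Qed.

Lemma nbwalksSS m i j :
  nbwalks m.+3 i j =
  \sum_q (e i q)%:R * nbwalks m.+2 q j - (d%:Z - 1) * nbwalks m.+1 i j.
Proof. by rewrite nbwalksS sum_nbwalks_avoiding addrK. Qed.

Lemma Gpoly_nbwalks m i j :
  horner_mx A (Gpoly d m.+1) i j =
  horner_mx A (Gpoly d m) i j + nbwalks m.+1 i j.
Proof.
have G0 : horner_mx A (Gpoly d 0) = 1%:M by rewrite rmorph1.
have G1 : horner_mx A (Gpoly d 1) = A + 1%:M.
  by rewrite /= rmorphD rmorph1 /= horner_mx_X.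
have n1 i' j' : nbwalks 1 i' j' = (e i' j')%:R.
  rewrite /= -sum_adj (bigD1 j') //= eqxx mulr1 big1 ?addr0 // => k.
  by move/negPf->; rewrite mulr0.
elim/ltn_ind: m i j => -[|[|m]] IHm i j.
- by rewrite G0 G1 n1 !mxE addrC.
(* Length 2 is separate: after an immediate return the empty walk remains, which avoids every [q],
   so the factor is d instead of d - 1. *)
- have := nbwalksS 0 i j.
  rewrite horner_mx_GpolySS G0 G1 mulmxDr mulmx1 !mxE.
  rewrite (eq_bigr (fun q => A i q * A q j)); last first.
    by move=> q _; rewrite n1 !mxE.
  move=> ->; rewrite -[\sum_(q | _) _]sum_adj /= -mulr_suml e_reg; lia.
- rewrite horner_mx_GpolySS [in RHS]horner_mx_GpolySS nbwalksSS.
  rewrite !(mxE _ _ i j) IHm //.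
  rewrite (eq_bigr (fun q => A i q * horner_mx A (Gpoly d m.+1) q j +
                        (e i q)%:R * nbwalks m.+2 q j)).
    by rewrite big_split mulrDr opprD addrACA.
  by move=> q _; rewrite (IHm m.+1) // mulrDr (_ : (e i q)%:R = A i q) ?mxE.
Qed.

Lemma Gpoly_mx_le k m i j : (k <= m)%N ->
  horner_mx A (Gpoly d k) i j <= horner_mx A (Gpoly d m) i j.
Proof.
elim: m => [|m IHm]; first by rewrite leqn0 => /eqP->.
rewrite leq_eqVlt => /predU1P[->//|/IHm le_km].
by apply: le_trans le_km _; rewrite Gpoly_nbwalks lerDl nbwalks_ge0.
Qed.

End NonBacktracking.

(** * Shifts and parity on Z/n *)

Lemma Zp_shift_const (q : nat) (T : Type) (f : 'I_q.+2 -> T) :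
  (forall i, f (i + 1) = f i) -> forall i, f i = f 0.
Proof.
move=> fS i; rewrite -(natr_Zp i).
by elim: (i : nat) => [|m IHm] //; rewrite -addn1 natrD fS.
Qed.

(** The alternatives exclude each other, since i + 2 differs from i when n >= 3. *)
Lemma Zp_succ_or (q : nat) (i j : 'I_q.+2) : (0 < q)%N ->
  ((j == i + 1) || (i == j + 1))%:R = (j == i + 1)%:R + (i == j + 1)%:R :> int.
Proof.
move=> q_gt0; have [->|_] := eqVneq j (i + 1); last by rewrite add0r.
rewrite -addrA -[X in X == _]addr0 (inj_eq (addrI _)) [_ == _]negbTE //.
by apply/eqP => /(congr1 val) /=; rewrite modn_small //; lia.
Qed.

Section Parity.
Variable q : nat.
Hypothesis even_q : odd q = false.
Implicit Types i j t : 'I_q.+2.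

(** For even n this is the character of order 2 of Z/n. *)
Definition sgn i : int := (-1) ^+ (i : nat).

Lemma sgn0 : sgn 0 = 1. Proof. by []. Qed.

Lemma sgn1 : sgn 1 = -1. Proof. by []. Qed.

Lemma sgnD i j : sgn (i + j) = sgn i * sgn j.
Proof. by rewrite /sgn -signr_odd /= odd_mod ?signr_odd ?exprD //= even_q. Qed.

Lemma sgnK i : sgn i * sgn i = 1.
Proof. by rewrite /sgn -expr2 sqrr_sign. Qed.

Lemma sgnN i : sgn (- i) = sgn i.
Proof. by rewrite -[LHS]mul1r -(sgnK i) -mulrA -sgnD subrr sgn0 mulr1. Qed.

Lemma sgn_or i : sgn i = 1 \/ sgn i = -1.
Proof. by rewrite /sgn -signr_odd; case: odd; [right | left]. Qed.

Lemma sgn_half i : sgn i = 1 -> exists t, i = t + t.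
Proof.
rewrite /sgn -signr_odd; case: (boolP (odd i)) => // ev _.
by exists (i./2)%:R; rewrite -natrD addnn -{1}(natr_Zp i) even_halfK.
Qed.

Lemma sgn_sqr i : sgn (i + i) = 1.
Proof. by rewrite sgnD sgnK. Qed.

End Parity.

Arguments sgn {q} i.

(** * Regular graphs with G(A) = J + eps B, where B is the standard cycle on Z/n *)

Section CyclicRegular.
Variables (q d k : nat) (e : rel 'I_q.+2) (eps : int).
Hypotheses (q_gt0 : (0 < q)%N) (d_odd : odd d) (d_ge5 : (5 <= d)%N).
Hypotheses (k_ge2 : (2 <= k)%N) (eps_sign : eps = 1 \/ eps = -1).
Hypotheses (e_sym : symmetric e) (e_irr : irreflexive e).
Hypothesis e_reg : forall i, \sum_j (e i j)%:R = d%:Z.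
Implicit Types i j t s : 'I_q.+2.

Let a i j : int := (e i j)%:R.
Let b i j : int := (j == i + 1)%:R + (i == j + 1)%:R.
Let A : 'M[int]_q.+2 := \matrix_(i, j) (e i j)%:R.
Let A2 i j : int := \sum_l a i l * a l j.

Hypothesis GA : forall i j, horner_mx A (Gpoly d k) i j = 1 + eps * b i j.

Lemma a01 i j : a i j = 0 \/ a i j = 1.
Proof. by rewrite /a; case: (e i j); [right | left]. Qed.

Lemma aC i j : a i j = a j i. Proof. by rewrite /a e_sym. Qed.

Lemma aii i : a i i = 0. Proof. by rewrite /a e_irr. Qed.

Lemma bC i j : b i j = b j i. Proof. by rewrite /b addrC. Qed.

Lemma b01 i j : b i j = 0 \/ b i j = 1.
Proof. by rewrite /b -Zp_succ_or //; case: (_ || _); [right | left]. Qed.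

Lemma sum_b i (f : 'I_q.+2 -> int) :
  \sum_j b i j * f j = f (i + 1) + f (i - 1).
Proof.
rewrite /b; under eq_bigr do rewrite mulrDl.
rewrite big_split /=; congr (_ + _).
  rewrite (bigD1 (i + 1)) //= eqxx mul1r big1 ?addr0 // => j.
  by move/negPf->; rewrite mul0r.
rewrite (bigD1 (i - 1)) //= subrK eqxx mul1r big1 ?addr0 // => j.
by rewrite eq_sym subr_eq; move/negPf->; rewrite mul0r.
Qed.

Lemma sum_b1 i : \sum_j b i j = 2.
Proof.
by under eq_bigr do rewrite -[b _ _]mulr1; rewrite (sum_b i (fun=> 1)).
Qed.

Lemma mulmx_A (f : 'I_q.+2 -> int) i :
  (A *m \col_j f j) i 0 = \sum_j a i j * f j.
Proof. by rewrite mxE; apply: eq_bigr => j _; rewrite !mxE. Qed.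

(** J + eps B is applied to an eigenvector [f] of A, on which G(A) acts as the scalar G(c). *)
Lemma sum_GA (c : int) (f : 'I_q.+2 -> int) :
    (forall i, \sum_j a i j * f j = c * f i) ->
  forall i, \sum_j f j + eps * (f (i + 1) + f (i - 1)) = (Gpoly d k).[c] * f i.
Proof.
move=> fE i; have Af : A *m \col_j f j = c *: \col_j f j.
  by apply/matrixP=> i' o; rewrite ord1 mulmx_A fE !mxE.
have /matrixP/(_ i 0) := horner_mx_eigen _ _ _ (Gpoly d k) _ _ Af.
rewrite !mxE => <-; rewrite -sum_b mulr_sumr -big_split /=.
by apply: eq_bigr => j _; rewrite GA !mxE; lia.
Qed.

Lemma sum_a1 i : \sum_j a i j * 1 = d%:Z * 1.
Proof. by rewrite mulr1 -(e_reg i); apply: eq_bigr => j _; rewrite mulr1. Qed.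

(** The all-ones vector gives n + 2 eps = G(d), which is even. *)
Lemma order_even : odd q = false.
Proof.
have := sum_GA d%:Z (fun=> 1) _ 0; rewrite sumr_const card_ord.
case: k k_ge2 => // k' _; have [x ->] := @horner_Gpoly_even d k' d_odd.
by move=> /(_ sum_a1); case: eps_sign => ->; lia.
Qed.

(** A commutes with G(A), and regularity cancels the contributions of J, leaving AB = BA. *)
Lemma wave i j : a (i + 1) j + a (i - 1) j = a i (j + 1) + a i (j - 1).
Proof.
have /matrixP/(_ i j) : A *m horner_mx A (Gpoly d k) =
    horner_mx A (Gpoly d k) *m A.
  by apply/esym/comm_horner_mx.
rewrite !mxE.
rewrite (eq_bigr (fun l => a i l + eps * (b j l * a i l))); last first.
  by move=> l _; rewrite GA bC !mxE -/(a i l); lia.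
rewrite [RHS](eq_bigr (fun l => a j l + eps * (b i l * a l j))); last first.
  by move=> l _; rewrite GA !mxE -/(a l j) aC; lia.
rewrite !big_split /= !e_reg -!mulr_sumr.
rewrite (sum_b j (fun l => a i l)) (sum_b i (fun l => a l j)).
by case: eps_sign => ->; lia.
Qed.

(** G_2 = x^2 + x - (d - 1) is compared with G_k; both signs of [eps] fit the bound because b >=
    0. *)
Lemma A2_le i j : i != j -> A2 i j + a i j <= 1 + b i j.
Proof.
move=> ne_ij; have := @Gpoly_mx_le _ d e e_sym e_reg _ _ i j k_ge2.
rewrite GA horner_mx_GpolySS /= rmorphD !rmorph1 /= horner_mx_X mulmxDr mulmx1.
rewrite !mxE (negPf ne_ij) mulr0 subr0 -/(a i j).
rewrite (eq_bigr (fun l => a i l * a l j)); last by move=> l _; rewrite !mxE.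
rewrite -/(A2 i j).
by case: eps_sign => ->; case: (b01 i j) => ->; lia.
Qed.

Lemma A2_ge0 i j : 0 <= A2 i j.
Proof. by apply: sumr_ge0 => l _; rewrite mulr_ge0 ?ler0n. Qed.

Lemma sum_A2 (c : int) (f : 'I_q.+2 -> int) :
    (forall i, \sum_j a i j * f j = c * f i) ->
  forall i, \sum_j A2 i j * f j = c * c * f i.
Proof.
move=> fE i; rewrite /A2; under eq_bigr do rewrite mulr_suml.
rewrite exchange_big /= -mulrA -fE mulr_sumr; apply: eq_bigr => l _.
under eq_bigr do rewrite -mulrA.
by rewrite -mulr_sumr fE; lia.
Qed.

Lemma A2ii i : A2 i i = d%:Z.
Proof.
rewrite -(e_reg i); apply: eq_bigr => l _; rewrite (aC l) /a.
by case: (e i l).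
Qed.

(* In an abelian Cayley graph the walks i, l, j and i, i + j - l, j come in
   pairs, so a unique midpoint l satisfies 2 l = i + j. *)
Lemma not_circulant : ~ (forall i j, a (i + 1) (j + 1) = a i j).
Proof.
move=> aS; have aD t i j : a (i + t) (j + t) = a i j.
  rewrite (@Zp_shift_const q _ (fun t => a (i + t) (j + t))) ?addr0 // => t'.
  by rewrite !addrA.
have a_refl i j l : a i (i + j - l) = a l j.
  by rewrite -(aD (l - i)) addrC subrK addrA subrK addrAC subrr add0r.
(* The neighbours of [i] that are fixed midpoints of the pairing. *)
pose u i j : int := \sum_l a i l * (l + l == i + j)%:R.
have u_ge0 i j : 0 <= u i j by apply: sumr_ge0 => l _; rewrite mulr_ge0 ?ler0n.
have A2_u i j : i != j -> A2 i j <= u i j + 2 * b i j.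
  move=> ne_ij; have := A2_le _ _ ne_ij; have := A2_ge0 i j; have := u_ge0 i j.
  have : 0 <= a i j by exact: ler0n.
  case: (b01 i j) => ->; last by lia.
  move=> ? ? ? ?; suff : 0 < A2 i j -> 1 <= u i j by lia.
  (* Here b = 0, so there is at most one midpoint, and the pairing must fix it. *)
  move=> A2_gt0.
  have [l al]: exists l, a i l * a l j = 1.
    apply: contrapT => no; move: A2_gt0; rewrite /A2 big1 ?ltxx // => l _.
    case: (a01 i l) (a01 l j) => [E1|E1] [E2|E2]; rewrite ?E1 ?E2 //.
    by case: no; exists l; rewrite E1 E2.
  have al' : a i (i + j - l) * a (i + j - l) j = 1.
    by rewrite a_refl (aC (i + j - l)) [i + j]addrC a_refl mulrC (aC l i).
  have El : i + j - l = l.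
    apply: contrapT => /eqP ne.
    have : A2 i j = 1 + (1 +
        \sum_(l' | (l' != l) && (l' != i + j - l)) a i l' * a l' j).
      by rewrite /A2 (bigD1 l) //= (bigD1 (i + j - l)) //= al al'.
    have : 0 <= \sum_(l' | (l' != l) && (l' != i + j - l)) a i l' * a l' j.
      by apply: sumr_ge0 => l' _; rewrite mulr_ge0 ?ler0n.
    by lia.
  have Ell : l + l = i + j by rewrite -{1}El subrK.
  rewrite /u (bigD1 l) //= Ell eqxx mulr1.
  have -> : a i l = 1 by case: (a01 i l) al => -> //; rewrite mul0r.
  rewrite lerDl; apply: sumr_ge0 => l' _; exact: mulr_ge0.
have sum_u i : \sum_j u i j = d%:Z.
  rewrite /u exchange_big /= -(e_reg i); apply: eq_bigr => l _.
  rewrite -mulr_sumr (bigD1 (l + l - i)) //= [i + _]addrC subrK eqxx.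
  rewrite big1 ?addr0 ?mulr1 // => j.
  by move=> ne; rewrite [i + j]addrC -subr_eq eq_sym (negPf ne).
(* Row 0 of A^2 sums to d^2, but its diagonal entry is d and the others add up to at most d + 4,
   impossible for d >= 5. *)
have := sum_A2 _ _ sum_a1 0; under eq_bigr do rewrite mulr1.
rewrite (bigD1 0) //= A2ii.
have : \sum_(j | j != 0) A2 0 j <= \sum_(j | j != 0) (u 0 j + 2 * b 0 j).
  by apply: ler_sum => j; rewrite eq_sym; apply: A2_u.
have : \sum_(j | j != 0) (u 0 j + 2 * b 0 j) <= \sum_j (u 0 j + 2 * b 0 j).
  by rewrite [leRHS](bigD1 0) //= lerDr addr_ge0 // mulr_ge0 // addr_ge0.
have : \sum_j (u 0 j + 2 * b 0 j) = d%:Z + 4.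
  by rewrite big_split /= -mulr_sumr sum_u sum_b1.
move=> -> le1 le2; have := le_trans le2 le1.
by set S := \sum_(j | j != 0) _; nia.
Qed.

(** * Solving the wave equation on the two parity classes *)

Let D i j := a (i + 1) (j + 1) - a i j.
Let E i j := a (i + 1) j - a i (j + 1).

Fact sub_swap (x y z t : int) : x + t = z + y -> x - y = z - t.
Proof. by lia. Qed.

(** The wave equation regrouped: for a = f(i - j) + g(i + j), [D] is an increment of g alone, and
    [E] one of f alone. *)
Lemma D_shift t i j : D (i + t) (j - t) = D i j.
Proof.
rewrite (@Zp_shift_const q _ (fun t => D (i + t) (j - t)))
  ?addr0 ?subr0 // => t'.
rewrite -[j - t'](subrK 1) opprD !addrA.
by apply: sub_swap; have := wave (i + t' + 1) (j - t' - 1 + 1); rewrite !addrK.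
Qed.

Lemma E_shift t i j : E (i + t) (j + t) = E i j.
Proof.
rewrite (@Zp_shift_const q _ (fun t => E (i + t) (j + t))) ?addr0 // => t'.
rewrite !addrA; apply: sub_swap; rewrite [RHS]addrC.
by have := wave (i + t' + 1) (j + t' + 1); rewrite !addrK.
Qed.

(* If D takes the value 1 (resp. -1) on an antidiagonal then a is constantly 0
   (resp. 1) there, so that E vanishes next to it. *)
Lemma D_neq0_E0 i0 j0 : D i0 j0 <> 0 ->
  forall i j, sgn (i + j) = - sgn (i0 + j0) -> E i j = 0.
Proof.
move=> D0 i j sgnE.
have Dc i' j' : i' + j' = i0 + j0 -> D i' j' = D i0 j0.
  move=> Eij; rewrite -(D_shift (i0 - i')) [i' + _]addrC subrK.
  by rewrite opprB addrA [j' + i']addrC Eij [i0 + j0]addrC addrK.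
have ac i' j' : i' + j' = i0 + j0 -> a i' j' = a i0 j0.
  move=> /Dc; move: D0; rewrite /D.
  by case: (a01 i' j') (a01 i0 j0) (a01 (i' + 1) (j' + 1))
    (a01 (i0 + 1) (j0 + 1)) =>
    [->|->] [->|->] [->|->] [->|->].
(* Moving by [t] along the diagonal puts both entries compared by [E] on the antidiagonal of (i0,
   j0). *)
have [t Et] : exists t, i0 + j0 - 1 - (i + j) = t + t.
  apply: sgn_half.
  rewrite !sgnD ?sgnN ?sgn1 ?order_even // -?sgnD ?order_even // sgnE.
  by have := sgnK _ (i0 + j0); lia.
rewrite -(E_shift t) /E; apply/eqP; rewrite subr_eq0; apply/eqP.
have Es : i + t + (j + t) + 1 = i0 + j0.
  by rewrite addrACA -Et [i + j + _]addrC !subrK.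
rewrite ac; last by rewrite addrAC Es.
by rewrite ac // addrA Es.
Qed.

(** [E i j] compares neighbouring entries of the antidiagonal i + j + 1, hence the change of
    sign. *)
Lemma E0_shift (c : int) : (forall i j, sgn (i + j) = c -> E i j = 0) ->
  forall t i j, sgn (i + j) = - c -> a (i + t) (j - t) = a i j.
Proof.
move=> E0 t i j cE.
rewrite (@Zp_shift_const q _ (fun t => a (i + t) (j - t)))
  ?subr0 ?addr0 // => t'.
apply/eqP; rewrite -subr_eq0 -[j - t'](subrK 1) addrA opprD addrA; apply/eqP.
apply: E0; rewrite addrA addrACA subrr addr0.
by rewrite sgnD ?order_even // sgnN ?order_even // sgn1 cE; lia.
Qed.

(** Otherwise [a] is constant on even antidiagonals; each of them meets the main diagonal, so [a]
    vanishes on the even class and [D] with it. *)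
Lemma even_circulant i j : sgn (i + j) = 1 -> D i j = 0.
Proof.
move=> sgnE; apply: contrapT => D0.
have a0 i' j' : sgn (i' + j') = 1 -> a i' j' = 0.
  move=> sgn'; have [x Ex] := sgn_half _ _ sgn'.
  rewrite -[i'](subrK x) addrC.
  have -> : j' = x - (i' - x).
    by apply/eqP; rewrite opprB addrA -Ex addrAC subrr add0r.
  rewrite (@E0_shift (-1)) ?aii ?sgn_sqr ?order_even //.
  by move=> i1 j1 s1; apply: (D_neq0_E0 i j) => //; rewrite s1 sgnE.
apply: D0; rewrite /D !a0 // addrACA sgnD ?order_even // sgnE.
by rewrite sgn_sqr ?order_even.
Qed.

(** As the circulant case is excluded, [D] is nonzero somewhere, necessarily on the odd class. *)
Lemma odd_anticirculant i j t : sgn (i + j) = -1 -> a (i + t) (j - t) = a i j.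
Proof.
move=> sgnE; have [i0 [j0 D0]] : exists i0 j0, D i0 j0 <> 0.
  apply: contrapT => noD; apply: not_circulant => i' j'.
  apply/eqP; rewrite -subr_eq0; apply/eqP; apply: contrapT => D0.
  by apply: noD; exists i', j'.
apply: (@E0_shift 1) => // i1 j1 s1; apply: (D_neq0_E0 _ _ D0).
rewrite s1; case: (sgn_or _ (i0 + j0)) => [/even_circulant//|->].
by rewrite opprK.
Qed.

Lemma even_shift t i j : sgn (i + j) = 1 -> a (i + t) (j + t) = a i j.
Proof.
move=> sgnE.
rewrite (@Zp_shift_const q _ (fun t => a (i + t) (j + t))) ?addr0 // => t'.
apply/eqP; rewrite -subr_eq0 !addrA; apply/eqP; apply: even_circulant.
by rewrite addrACA sgnD ?order_even // sgnE sgn_sqr ?order_even.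
Qed.

(** * The dihedral case and the alternating eigenvector *)

Let theta : int := \sum_j a 0 j * sgn j.

Lemma sum_a_sgn i : \sum_j a i j * sgn j = theta * sgn i.
Proof.
(* Twice the number of neighbours of [i] with its own parity, constant because the even class is
   circulant. *)
pose h i := \sum_j a i j * (1 + sgn (i + j)).
have hS i' : h (i' + 1) = h i'.
  rewrite /h (reindex_inj (addIr 1)) /=; apply: eq_bigr => j _.
  rewrite addrACA (sgnD _ order_even (i' + j)) (sgn_sqr _ order_even) mulr1.
  case: (sgn_or _ (i' + j)) => sE; last by rewrite sE !mulr0.
  by rewrite even_shift.
have hE i' : h i' = d%:Z + sgn i' * \sum_j a i' j * sgn j.
  rewrite -(e_reg i') mulr_sumr -big_split; apply: eq_bigr => j _.
  by rewrite (sgnD _ order_even) mulrDr mulr1 mulrCA.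
have := Zp_shift_const _ _ _ hS i; rewrite !hE sgn0 mul1r => /addrI.
rewrite -/theta => <-.
by rewrite mulrAC sgnK mul1r.
Qed.

(* The walks i, l, j and i, l + j - i, j are exchanged by the relation
   between rotations and reflections of a dihedral group. *)
Lemma A2_odd i j : sgn (i + j) = -1 -> A2 i j <= 2 * b i j.
Proof.
move=> sgnE; have ne_ij : i != j.
  by apply/eqP => Eij; move: sgnE; rewrite Eij sgn_sqr ?order_even.
(* As j - i is odd, the exchange swaps the two parities of midpoints, so [A2 i j] is even; an even
   number at most 1 + b is at most 2 b. *)
have [x Ex] : exists x : int, A2 i j = 2 * x.
  exists (\sum_(l | sgn (i + l) == 1) a i l * a l j).
  rewrite /A2 (bigID (fun l => sgn (i + l) == 1)) /= mulr2n mulrDl mul1r.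
  congr (_ + _); rewrite (reindex_inj (addIr (j - i))) /=.
  have sgn_ji : sgn (j - i) = -1.
    by rewrite sgnD ?sgnN ?order_even // -sgnD ?order_even // addrC.
  apply: eq_big => l.
    rewrite (addrA i) (sgnD _ order_even (i + l)) sgn_ji.
    by case: (sgn_or _ (i + l)) => ->.
  rewrite (addrA i) (sgnD _ order_even (i + l)) sgn_ji => sl.
  have {}sl : sgn (i + l) = 1 by case: (sgn_or _ (i + l)) sl => ->.
  have sgn_lj : sgn (l + j) = -1.
    rewrite -[l + j]add0r -(subrr i) addrACA.
    by rewrite (sgnD _ order_even) sl mul1r addrC.
  rewrite mulrC; congr (_ * _).
    by rewrite (aC i l) -(even_shift (j - i) l i) ?[i + (j - i)]addrC
      ?subrK // addrC.
  rewrite -(odd_anticirculant _ _ (i - l) sgn_lj).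
  by rewrite [l + (i - l)]addrC subrK opprB addrCA.
have := A2_le _ _ ne_ij; have := A2_ge0 i j; have : 0 <= a i j by exact: ler0n.
by rewrite Ex; case: (b01 i j) => ->; lia.
Qed.

Lemma no_cyclic_regular : False.
Proof.
have le_theta : `|theta| <= d%:Z.
  rewrite -(e_reg 0); apply: le_trans (ler_norm_sum _ _ _) _.
  by apply: ler_sum => j _; rewrite normrM /sgn normrX normrN1 expr1n
    mulr1 ger0_norm ?ler0n.
have sum_sgn_b : \sum_j b 0 j * sgn j = -2.
  by rewrite sum_b sub0r add0r sgnN ?order_even // sgn1.
(* The weight 1 - sgn j singles out odd j; the outcome is d^2 - theta^2 <= 8. *)
have : \sum_j A2 0 j * (1 - sgn j) <= \sum_j 2 * (b 0 j * (1 - sgn j)).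
  apply: ler_sum => j _; rewrite mulrA.
  case: (sgn_or _ j) => sE; first by rewrite sE subrr !mulr0.
  by rewrite ler_wpM2r ?sE // A2_odd // add0r.
have -> : \sum_j A2 0 j * (1 - sgn j) = d%:Z * d%:Z - theta * theta.
  under eq_bigr do rewrite mulrBr.
  by rewrite sumrB (sum_A2 _ _ sum_a1) (sum_A2 _ _ sum_a_sgn) sgn0 !mulr1.
have -> : \sum_j 2 * (b 0 j * (1 - sgn j)) = 8.
  rewrite -mulr_sumr; under eq_bigr do rewrite mulrBr mulr1.
  by rewrite sumrB sum_b1 sum_sgn_b.
(* If |theta| <= d - 1, then d^2 - theta^2 >= 2 d - 1 >= 9. *)
move=> theta8; have theta_d : theta = d%:Z \/ theta = - d%:Z.
  have [lt|ge] : `|theta| <= d%:Z - 1 \/ d%:Z <= `|theta| by lia.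
    by have := ler_pM (normr_ge0 _) (normr_ge0 _) lt lt; rewrite -normrM; lia.
  by lia.
have sum_sgn0 : \sum_(j : 'I_q.+2) sgn j = 0.
  have : \sum_(j : 'I_q.+2) sgn j = - \sum_(j : 'I_q.+2) sgn j; last by lia.
  rewrite {1}(reindex_inj (addIr 1)) -sumrN; apply: eq_bigr => j _.
  by rewrite sgnD ?order_even // sgn1 mulrN1.
(* J kills the alternating vector and B has eigenvalue -2 on it, so G(theta) = -2 eps. *)
have := sum_GA _ _ sum_a_sgn 0.
rewrite sum_sgn0 !add0r sgnN ?order_even // sgn1 sgn0 mulr1.
case: theta_d => ->.
  by have := @horner_Gpoly_ge d k; case: eps_sign => ->; lia.
rewrite horner_GpolyN.
case: k k_ge2 => [|k'] // _ /(congr1 Num.norm).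
rewrite normrX exprS; have : 1 <= `|1 - d%:Z| ^+ k' by apply: exprn_ege1; lia.
by case: eps_sign => ->; nia.
Qed.

End CyclicRegular.

(** * Return to graphs: numbering the vertices along the cycle, and the count *)

Lemma no_cyclic_mx (d k : nat) (G : sgraph) (eps : int)
    (B : 'M[int]_((order_pred G).+1)) :
  odd d -> (5 <= d)%N -> (2 <= k)%N -> eps = 1 \/ eps = -1 -> regular d G ->
  is_cycle_matrix B ->
  horner_mx (adj_mx G) (Gpoly d k) <> const_mx 1 + eps *: B.
Proof.
case: G B => -[|q] e e_sym e_irr B d_odd d_ge5 k_ge2 eps_sign reg [] //= n_ge3.
case=> v ->; set A := adj_mx _ => GA.
pose e' : rel 'I_q.+2 := fun i j => e (v i) (v j).
apply: (@no_cyclic_regular q d k e' eps) => // [i j|i|i|i j].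
- exact: e_sym.
- exact: e_irr.
- rewrite -(reg (v i)) cardsE -sum1_card -natz natr_sum /=.
  rewrite [RHS](reindex_inj (@perm_inj _ v)) [RHS]big_mkcond /=.
  by apply: eq_bigr => j _; rewrite unfold_in /e' /=; case: (e _ _).
- rewrite (_ : (\matrix_(_, _) _) = mxsub v v A); last first.
    by apply/matrixP => i' j'; rewrite !mxE.
  rewrite horner_mx_mxsub GA !mxE; congr (_ + _ * _).
  have ordSE (l : 'I_q.+2) : ordS l = l + 1.
    by apply: val_inj; rewrite /= modnDmr addn1.
  rewrite (_ : [exists l, _] = (j == i + 1) || (i == j + 1)); last first.
    apply/existsP/orP => [[l]|[]/eqP Eij].
    + by rewrite !(inj_eq perm_inj) ordSE => /orP[]/andP[/eqP-> /eqP->];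
        [left | right].
    + by exists i; rewrite !(inj_eq perm_inj) ordSE Eij !eqxx.
    + by exists j; rewrite !(inj_eq perm_inj) ordSE Eij !eqxx orbT.
  exact: Zp_succ_or.
Qed.

Lemma cyclic_graphs0 (d : nat) : odd d -> (5 <= d)%N -> cyclic_graphs d = set0.
Proof.
move=> d_odd d_ge5; apply/seteqP; split=> // G.
case=> [[D [_ reg D_ge2 _ [B cycB GA]]]|[g [_ reg [_ g_ge5] _ [B cycB GA]]]].
  apply: (@no_cyclic_mx d D G 1 B) => //; first by left.
  by rewrite scale1r.
apply: (@no_cyclic_mx d g./2 G (-1) B) => //; [by lia | by right |].
by rewrite scaleN1r.
Qed.

Theorem theorem11 (R : realType) :
  (forall d : nat, odd d -> (5 <= d)%N -> finite_set (cyclic_graph_classes d)) /\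
  ((fun d : nat => (num_cyclic_graphs d)%:R : R)
     =O_odd_oo
   (fun d : nat => 64 / 3 * d%:R `^ (3 / 2) : R)).
Proof.
have classes0 d : odd d -> (5 <= d)%N -> cyclic_graph_classes d = set0.
  by move=> ? ?; rewrite /cyclic_graph_classes cyclic_graphs0 // image_set0.
split=> [d d_odd d_ge5|]; first by rewrite classes0.
(* The count is 0 for odd d >= 5, so any positive constant will do. *)
apply/eqO_exP; exists 1 => //.
near=> d.
have d_odd : odd d by near: d; exact: withinT.
have d_ge5 : (5 <= d)%N.
  by near: d; apply: cvg_within; exact: nbhs_infty_ge.
rewrite /num_cyclic_graphs classes0 // fset_set0 cardfs0 normr0.
by rewrite mulr_ge0.
Unshelve. all: by end_near.
Qed.
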